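(* Let $R$ be a finite commutative Frobenius ring of characteristic $2$ that is a local ring whose residue class field contains $2$ elements. Let $p$ be a prime with $p=4k+3$ for an integer $k$, and assume that $k$ is even. For $i\in\{0,1,2\}$ let $a_i,b_i,c_i\in R$, let $Q_i=Q_p(a_i,b_i,c_i)$, and let $A_i$ be a $p\times p$ circulant matrix over $R$. Let $\mathcal{C}$ be the linear code of length $6p$ over $R$ generated by the rows of $$M=\left(\begin{array}{ccc|ccc} Q_0&Q_1&Q_2&A_0&A_1&A_2\\ Q_2&Q_0&Q_1&A_2&A_0&A_1\\ Q_1&Q_2&Q_0&A_1&A_2&A_0\end{array}\right).$$ If $\mathcal{C}$ is self-dual, then the matrix $\sum_{i=0}^2Q_i$ is invertible over $R$.
   Context: For $a,b,c\in R$ and a prime $p$, $Q_p(a,b,c)$ is the $p\times p$ circulant matrix (each row is the right cyclic shift by one position of the row above it) whose first row $(r_0,r_1,\dots,r_{p-1})$ is given by $r_0=a$; $r_i=b$ if $i\neq 0$ is a quadratic residue modulo $p$; $r_i=c$ if $i$ is a quadratic non-residue modulo $p$. A code of length $n$ over $R$ is an $R$-submodule of $R^n$; its dual is $\mathcal{C}^\perp=\{x\in R^n : \sum_i x_iy_i=0 \text{ for all } y\in \mathcal{C}\}$ (Euclidean inner product). $\mathcal{C}$ is self-dual if $\mathcal{C}=\mathcal{C}^\perp$. *)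

(* Defs.v *)
From HB Require Import structures.
From mathcomp Require Import all_boot all_order all_algebra.

Set Implicit Arguments.
Unset Strict Implicit.
Unset Printing Implicit Defensive.

Import GRing.Theory.
Local Open Scope ring_scope.

Section FiniteCommutativeRings.

Variable R : finComNzRingType.
Implicit Types I : {set R}.

Definition is_ideal I : bool :=
  [&& 0 \in I,
      [forall x in I, forall y in I, x + y \in I] &
      [forall r : R, forall x in I, r * x \in I]].

Definition maximal_ideal I : bool :=
  maxset [pred K : {set R} | is_ideal K && (K != [set: R])] I.

Definition minimal_ideal I : bool :=
  minset [pred K : {set R} | is_ideal K && (K != [set 0])] I.

Definition ideal_coset I (x : R) : {set R} := [set x + y | y in I].

Definition ideal_quotient I : {set {set R}} := [set ideal_coset I x | x : R].

Definition jacobson : {set R} := \bigcap_(K : {set R} | maximal_ideal K) K.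

(* The sum of the minimal ideals, i.e. the least ideal containing them all.  *)
Definition socle : {set R} :=
  \bigcap_(K : {set R} |
    is_ideal K && [forall N : {set R}, minimal_ideal N ==> (N \subset K)]) K.

(* R / J(R) and Soc(R) are isomorphic as R-modules; f is only relevant on    *)
(* the cosets of J(R). The left and right versions agree as R is commutative. *)
Definition frobenius_ring : Prop :=
  exists f : {set R} -> R,
    [/\ forall x y, f (ideal_coset jacobson (x + y)) =
                    f (ideal_coset jacobson x) + f (ideal_coset jacobson y),
        forall r x, f (ideal_coset jacobson (r * x)) =
                    r * f (ideal_coset jacobson x),
        {in ideal_quotient jacobson &, injective f} &
        f @: ideal_quotient jacobson = socle].

Definition local_ring : Prop := exists! m : {set R}, maximal_ideal m.

End FiniteCommutativeRings.

Arguments frobenius_ring R : clear implicits.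
Arguments local_ring R : clear implicits.

Section Circulant.

Variables (R : nzRingType) (p : nat).

(* ordS is the cyclic successor on 'I_p, so this says that every row is the  *)
(* right cyclic shift by one position of the row above it.                   *)
Definition is_circulant (A : 'M[R]_p) : Prop :=
  forall i j : 'I_p, A (ordS i) (ordS j) = A i j.

(* The circulant matrix with first row (r 0, ..., r p.-1); the column index  *)
(* is j - i modulo p.                                                        *)
Definition circulant_mx (r : nat -> R) : 'M[R]_p :=
  \matrix_(i < p, j < p) r ((j + (p - i)) %% p)%N.

Lemma circulant_mx_first_row (r : nat -> R) (i j : 'I_p) :
  i = 0%N :> nat -> circulant_mx r i j = r j.
Proof. by move=> i0; rewrite mxE i0 subn0 modnDr modn_small. Qed.

Lemma circulant_mxP (r : nat -> R) : is_circulant (circulant_mx r).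
Proof.
move=> i j; rewrite !mxE /=; congr r; apply/eqP.
have p_gt0 : (0 < p)%N := leq_ltn_trans (leq0n i) (ltn_ord i).
rewrite -(eqn_modDr (i.+1 %% p)%N) -addnA subnK; last exact/ltnW/ltn_pmod.
rewrite modnDr modn_mod modnDmr addnS -addnA subnK; last exact/ltnW.
by rewrite -addSn modnDr.
Qed.

(* Only meant for i != 0 modulo p. *)
Definition quadratic_residue (i : nat) : bool :=
  [exists x : 'I_p, (x ^ 2 == i %[mod p])%N].

Definition quadratic_circulant (a b c : R) : 'M[R]_p :=
  circulant_mx (fun i => if i == 0%N then a
                         else if quadratic_residue i then b else c).

(* Indices in 'I_3 are integers modulo 3. *)
Definition block_circulant3 (B : 'I_3 -> 'M[R]_p) :
    'M[R]_(p + (p + p), p + (p + p)) :=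
  col_mx (row_mx (B 0) (row_mx (B 1) (B 2)))
 (col_mx (row_mx (B 2) (row_mx (B 0) (B 1)))
         (row_mx (B 1) (row_mx (B 2) (B 0)))).

End Circulant.

Section Codes.

Variable R : finComNzRingType.

Definition row_code m n (M : 'M[R]_(m, n)) : {set 'rV[R]_n} :=
  [set u *m M | u : 'rV[R]_m].

Definition dual_code n (C : {set 'rV[R]_n}) : {set 'rV[R]_n} :=
  [set x : 'rV[R]_n | [forall y in C, \sum_(i < n) x 0 i * y 0 i == 0]].

Definition self_dual n (C : {set 'rV[R]_n}) : Prop := C = dual_code C.

End Codes.

(* Main.v *)
Require Import Defs.
From HB Require Import structures.
From mathcomp Require Import all_boot all_order all_algebra.
From mathcomp Require Import zify.

Set Implicit Arguments.
Unset Strict Implicit.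
Unset Printing Implicit Defensive.

Import GRing.Theory.
Local Open Scope ring_scope.

(** Modulo the maximal ideal everything lives over F_2, and a square matrix
over a local ring is invertible as soon as its reduction is.  Write Q and A for
the sums of the Q_i and of the A_i.

Self-duality survives the reduction in two ways.  First, M M^T = 0, and summing
the three block rows against the first one gives Q Q^T = A A^T (the
characteristic is 2).  Secondly, the 3p rows of M stay independent over F_2:
C has at most |R|^(3p) words, its dual at least |R|^(6p) / |R|^(3p), so
u |-> u M is injective (self_dual_inj); if u M vanished modulo the maximal
ideal for some u nonzero modulo it, multiplying by a nonzero socle element s,
which the Frobenius isomorphism provides, would give s u M = 0 with s u <> 0
(residue_rows_free).  Applied to the vectors (u, u, u), this shows that
u Q = u A = 0 forces u = 0 over F_2.

It remains to prove that u Q = 0 implies u A = 0.  Circulants are the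
polynomials f(P) in the cyclic shift P, and over F_2 squaring f(P) amounts to
replacing P by P^2.  As p is 3 modulo 8, 2^m = -1 modulo p for m = (p-1)/2
(Fp_two_pow_3mod8), hence P^(2^m) = P^-1 = P^T and B^T = B^(2^m) for each
circulant B over F_2 (tr_circulant_pow2).  So Q Q^T = A A^T reads Q^N = A^N
with N = 2^m + 1, and u Q = 0 gives u A^N = 0.  But A = A^(2^(2m)) because
transposing twice does nothing, and 2^(2m) >= N, so u A = 0
(det_circulant_neq0). *)

(** * The quadratic character of 2 *)

(** The classical evaluation of (1 + i)^p in characteristic p, with i a square
root J of -1 among the 2 x 2 matrices: Frobenius gives 1 - i, because p is
3 modulo 4, while (1 + i)^2 = 2 i gives 2^((p-1)/2) i^((p-1)/2) (1 + i). *)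
Lemma Fp_two_pow_3mod8 (p j : nat) :
  prime p -> p = (8 * j + 3)%N -> 2 ^+ (4 * j + 1) = -1 :> 'F_p.
Proof.
move=> p_pr def_p.
pose J : 'M['F_p]_2 := \matrix_(r, s) (if r == s then 0 else (-1) ^+ (r == 0)).
have JJ : J * J = -1.
  apply/matrixP=> r s; rewrite mxE !big_ord_recl big_ord0 !mxE.
  case: r => [[|[|//]] ?]; case: s => [[|[|//]] ?];
    by rewrite /= ?(mulr0, mul0r, addr0, add0r, expr1, expr0, mulr1, mul1r, oppr0,
                  mulr0n, mulr1n).
have J4 : J ^+ 4 = 1 by rewrite (exprM J 2 2) (expr2 J) JJ sqrrN expr1n.
have Jp : J ^+ p = - J.
  rewrite [X in _ ^+ X]def_p (_ : 8 * j + 3 = 4 * (2 * j) + 3)%N; last lia.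
  by rewrite exprD exprM J4 expr1n mul1r exprS expr2 JJ mulrN1.
have pM : p \in [pchar 'M['F_p]_2] by rewrite pchar_lalg pchar_Fp.
have frob : (1 + J) ^+ p = 1 - J.
  have /(pFrobenius_autD_comm pM) : GRing.comm 1 J by exact/commr_sym/commr1.
  by rewrite !pFrobenius_autE expr1n Jp.
have sqJ : (1 + J) ^+ 2 = 2 * J.
  by rewrite expr2 mulrDl mul1r mulrDr mulr1 JJ addrC addrA subrK mulr_natl.
have J4j : J ^+ (4 * j + 1) = J by rewrite exprD exprM J4 expr1n mul1r.
have: 2 ^+ (4 * j + 1) *: (J - 1) = 1 - J.
  rewrite -frob [X in _ = _ ^+ X]def_p (_ : 8 * j + 3 = 2 * (4 * j + 1) + 1)%N;
    last lia.
  rewrite [RHS]exprD [in RHS]exprM sqJ expr1 mulr_natl -scaler_nat exprZn J4j.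
  by rewrite -scalerAl mulrDr mulr1 JJ.
move=> /matrixP/(_ 0 0); rewrite !mxE /= subr0 add0r => /eqP.
by rewrite mulrN1 eqr_oppLR => /eqP.
Qed.


(** * Circulant matrices over F_2 *)

Definition shift_mx (F : nzRingType) n : 'M[F]_n.+1 :=
  \matrix_(i, j) (j == ordS i)%:R.

Lemma shift_mxX (F : nzRingType) n e (i j : 'I_n.+1) :
  (shift_mx F n ^+ e) i j = (j == (i + e) %% n.+1 :> nat)%N%:R.
Proof.
elim: e i j => [|e IHe] i j.
  by rewrite expr0 addn0 modn_small // mxE eq_sym.
rewrite exprS mxE (bigD1 (ordS i)) //= big1 => [|l /negPf il].
  by rewrite addr0 mxE eqxx mul1r IHe /= modnDml addSnnS.
by rewrite mxE il mul0r.
Qed.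

Lemma shift_mx_period (F : nzRingType) n : shift_mx F n ^+ n.+1 = 1.
Proof.
by apply/matrixP=> i j; rewrite shift_mxX modnDr modn_small // mxE eq_sym.
Qed.

Lemma tr_shift_mxK (F : comNzRingType) n : (shift_mx F n)^T * shift_mx F n = 1.
Proof.
apply/matrixP=> i j; rewrite mxE (bigD1 (ord_pred i)) //= big1 => [|l il].
  by rewrite addr0 !mxE ord_predK eqxx mul1r eq_sym.
rewrite !mxE; case: (i =P ordS l) => [il'|_]; last by rewrite mul0r.
by rewrite il' ordSK eqxx in il.
Qed.

Lemma circulant_row0_inj (F : nzRingType) n (A B : 'M[F]_n.+1) :
  is_circulant A -> is_circulant B -> A 0 =1 B 0 -> A = B.
Proof.
move=> cA cB eqAB; apply/matrixP=> -[i lti].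
elim: i lti => [|i IHi] lti j; first
  by rewrite (_ : Ordinal lti = 0) //; exact/val_inj.
have ->: Ordinal lti = ordS (Ordinal (ltnW lti))
  by apply/val_inj; rewrite /= modn_small.
by rewrite -(ord_predK j) cA cB IHi.
Qed.

Lemma is_circulant_shiftX (F : nzRingType) n e :
  is_circulant (shift_mx F n ^+ e).
Proof.
move=> i j; rewrite !shift_mxX /= modnDml addSn -[j.+1]addn1 -[(i + e).+1]addn1.
by rewrite eqn_modDr modn_small.
Qed.

Lemma circulant_poly (F : comNzRingType) n (A : 'M[F]_n.+1) :
  is_circulant A -> exists f, A = horner_mx (shift_mx F n) f.
Proof.
move=> cA; exists (\sum_(d < n.+1) A 0 d *: 'X^d); rewrite linear_sum /=.
rewrite (eq_bigr (fun d : 'I__ => A 0 d *: shift_mx F n ^+ d))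
  => [|d _]; last first.
  by rewrite linearZ /= rmorphXn /= horner_mx_X.
apply: circulant_row0_inj => //.
  by move=> i j; rewrite !summxE; apply: eq_bigr => d _;
     rewrite !mxE is_circulant_shiftX.
move=> j; rewrite summxE (bigD1 j) //= big1 => [|d /negPf dj].
  by rewrite addr0 mxE shift_mxX add0n modn_small // eqxx mulr1.
by rewrite mxE shift_mxX add0n modn_small // eq_sym
   (dj : (d == j :> nat) = false) mulr0.
Qed.

Lemma horner_mx_tr (F : comNzRingType) n (P : 'M[F]_n.+1) f :
  (horner_mx P f)^T = horner_mx P^T f.
Proof.
elim/poly_ind: f => [|f x IHf]; first by rewrite !rmorph0 trmx0.
rewrite [in RHS](mulrC f) !rmorphD !rmorphM /= !horner_mx_X !horner_mx_C.
by rewrite linearD /= tr_scalar_mx trmx_mul IHf.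
Qed.

(** Raising to the power 2^e is additive in characteristic 2 and fixes the
coefficients of f, which lie in F_2: it only acts on the argument. *)
Lemma horner_mx_pow2 n (P : 'M['F_2]_n.+1) f e :
  horner_mx P f ^+ (2 ^ e) = horner_mx (P ^+ (2 ^ e)) f.
Proof.
have pow2F (x : 'F_2) : x ^+ (2 ^ e) = x.
  have [-> | ->] : x = 0 \/ x = 1.
    by case: x => [[|[|//]] lt]; [left | right]; apply/val_inj.
  - by rewrite expr0n expn_eq0.
  - exact: expr1n.
have pow2D (g h : {poly 'F_2}) :
    (g + h) ^+ (2 ^ e) = g ^+ (2 ^ e) + h ^+ (2 ^ e).
  by apply: exprDn_pchar; rewrite pnatX pnatE // pchar_poly pchar_Fp.
elim/poly_ind: f => [|f x IHf]; first by rewrite !rmorph0 expr0n expn_eq0.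
rewrite -rmorphXn pow2D exprMn -polyC_exp pow2F !(rmorphD, rmorphM, rmorphXn) /=.
by rewrite IHf !horner_mx_X !horner_mx_C.
Qed.

(** For the shift P of order n.+1, both P^T and P^(2^m) are inverse to P; both
sides are then the value of one polynomial at P^-1. *)
Lemma tr_circulant_pow2 n m (A : 'M['F_2]_n.+1) :
  (n.+1 %| 2 ^ m + 1)%N -> is_circulant A -> A^T = A ^+ (2 ^ m).
Proof.
move=> dv /circulant_poly[f ->]; rewrite horner_mx_pow2 horner_mx_tr.
congr (horner_mx _ _).
rewrite -[LHS]mulr1 -(_ : shift_mx _ n ^+ (2 ^ m + 1) = 1).
  by rewrite addn1 exprS mulrA tr_shift_mxK mul1r.
by case/dvdnP: dv => q ->; rewrite mulnC exprM shift_mx_period expr1n.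
Qed.

Lemma tr_is_circulant (F : nzRingType) n (A : 'M[F]_n) :
  is_circulant A -> is_circulant A^T.
Proof. by move=> cA i j; rewrite !mxE. Qed.

(** A row vector u killed by A is killed by the power A^(2^m + 1) = A A^T, which
is also a power of B; since B is itself a higher power of B, u is killed by B
as well. *)
Lemma det_circulant_neq0 n m (A B : 'M['F_2]_n.+1) :
    (0 < m)%N -> (n.+1 %| 2 ^ m + 1)%N -> is_circulant A -> is_circulant B ->
    A *m A^T = B *m B^T ->
    (forall u : 'rV_n.+1, u *m A = 0 -> u *m B = 0 -> u = 0) ->
  \det A != 0.
Proof.
move=> m_gt0 dv cA cB eqAB free.
apply/det0P=> -[u /eqP nzu uA0]; apply/nzu/free => //.
have{eqAB} eqN : A ^+ (2 ^ m).+1 = B ^+ (2 ^ m).+1.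
  by rewrite !exprS -!(tr_circulant_pow2 dv).
have uBN : u *m B ^+ (2 ^ m).+1 = 0.
  by rewrite -eqN exprS mulmxA uA0 mul0mx.
have defB : B ^+ (2 ^ m * 2 ^ m) = B.
  rewrite exprM -(tr_circulant_pow2 dv cB) -tr_circulant_pow2 ?trmxK //.
  exact: tr_is_circulant.
have leN : ((2 ^ m).+1 <= 2 ^ m * 2 ^ m)%N.
  have : (2 ^ 1 <= 2 ^ m)%N by rewrite leq_exp2l.
  nia.
by rewrite -defB -(subnKC leN) exprD mulmxA uBN mul0mx.
Qed.

(** * Finite local rings with residue field F_2 *)

Lemma nonunit_subset_maximal (R : finComUnitRingType) (x : R) :
  x \isn't a GRing.unit -> exists2 K : {set R}, maximal_ideal K & x \in K.
Proof.
move=> nux; pose I : {set R} := [set r * x | r : R].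
have idI : is_ideal I && (I != [set: R]).
  apply/andP; split.
    apply/and3P; split.
    - by apply/imsetP; exists 0; rewrite ?mul0r.
    - apply/forall_inP=> _ /imsetP[r _ ->].
      apply/forall_inP=> _ /imsetP[s _ ->].
      by apply/imsetP; exists (r + s); rewrite ?mulrDl.
    - apply/forallP=> r; apply/forall_inP=> _ /imsetP[s _ ->].
      by apply/imsetP; exists (r * s); rewrite ?mulrA.
  apply: contraNneq nux => /setP/(_ 1); rewrite inE => /imsetP[r _ rx1].
  by apply/unitrPr; exists r; rewrite mulrC -rx1.
have [K maxK sIK] :=
  @maxset_exists _ [pred K : {set R} | is_ideal K && (K != [set: R])] I idI.
by exists K => //; apply: (subsetP sIK); apply/imsetP; exists 1; rewrite ?mul1r.
Qed.

Lemma maximal_ideal_closed (R : finComNzRingType) (K : {set R}) :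
  maximal_ideal K ->
  [/\ 0 \in K, {in K &, forall x y, x + y \in K},
      forall r, {in K, forall x, r * x \in K} & 1 \notin K].
Proof.
move=> /maxsetP[/andP[/and3P[K0 /forall_inP KD /forallP KM] KnT] _].
split=> // [x y xK yK | r x xK |].
- exact: (forall_inP (KD x xK)).
- exact: (forall_inP (KM r)).
- apply: contraNN KnT => K1; apply/eqP/setP=> x; rewrite inE.
  by rewrite -[x]mulr1 (forall_inP (KM x)).
Qed.

Lemma mem_maximal_local (R : finComUnitRingType) (K : {set R}) :
  local_ring R -> maximal_ideal K ->
  forall x, (x \in K) = (x \isn't a GRing.unit).
Proof.
move=> [L [_ Lu]] maxK x; apply/idP/idP => [xK|].
  have [_ _ KM K1] := maximal_ideal_closed maxK.
  by apply: contraNN K1 => ux; rewrite -(mulVr ux) KM.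
case/nonunit_subset_maximal => K' maxK' xK'.
by rewrite -(Lu K maxK) (Lu K' maxK').
Qed.

Lemma mem_coset_ideal (R : finComNzRingType) (K : {set R}) (x y : R) :
  (y \in ideal_coset K x) = (y - x \in K).
Proof.
apply/imsetP/idP => [[z zK ->]|yxK]; first by rewrite addrC addKr.
by exists (y - x); rewrite // addrC subrK.
Qed.

Lemma ideal_coset_eq0 (R : finComNzRingType) (K : {set R}) (x : R) :
  maximal_ideal K -> (ideal_coset K x == ideal_coset K 0) = (x \in K).
Proof.
move=> maxK; have [K0 KD KM _] := maximal_ideal_closed maxK.
apply/eqP/idP => [eqx|xK].
  by have := mem_coset_ideal K x x; rewrite eqx mem_coset_ideal subrr K0 subr0.
apply/setP=> y; rewrite !mem_coset_ideal subr0.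
apply/idP/idP => yK; first by rewrite -(subrK x y) KD.
by rewrite KD // -mulN1r KM.
Qed.

Lemma jacobson_local (R : finComNzRingType) (K : {set R}) :
  local_ring R -> maximal_ideal K -> jacobson R = K.
Proof.
move=> [L [_ Lu]] maxK; rewrite /jacobson (big_pred1 K) // => I /=.
by apply/idP/eqP => [maxI|-> //]; rewrite -(Lu I maxI) (Lu K maxK).
Qed.

(** With only two residue classes, the projection onto the residue field is the
indicator of the units. *)
Lemma residue_morphism (R : finComUnitRingType) :
  local_ring R ->
  (forall m : {set R}, maximal_ideal m -> #|ideal_quotient m| = 2%N) ->
  exists phi : {rmorphism R -> 'F_2},
    forall x, (phi x != 0) = (x \is a GRing.unit).
Proof.
move=> hloc hres; have [K [maxK _]] := hloc.
have memK := mem_maximal_local hloc maxK.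
have [K0 KD KM K1] := maximal_ideal_closed maxK.
have unitB x y : x \is a GRing.unit -> y \is a GRing.unit -> x - y \in K.
  move=> ux uy; pose c0 := ideal_coset K 0; pose cx := ideal_coset K x.
  have c0x z : z \is a GRing.unit -> c0 != ideal_coset K z.
    by move=> uz; rewrite eq_sym ideal_coset_eq0 // memK negbK.
  have /eqP def_Q : [set c0; cx] == ideal_quotient K.
    rewrite eqEcard cards2 c0x // hres // andbT; apply/subsetP=> z.
    by rewrite !inE => /orP[] /eqP ->; apply: imset_f.
  have: ideal_coset K y \in [set c0; cx] by rewrite def_Q imset_f.
  rewrite !inE eq_sym (negPf (c0x y uy)) /= => /eqP/setP/(_ x).
  by rewrite !mem_coset_ideal subrr K0 => ->.
pose phi (x : R) : 'F_2 := (x \is a GRing.unit)%:R.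
have KB x y : x \in K -> y \in K -> x - y \in K.
  by move=> xK yK; rewrite -mulN1r KD ?KM.
have phiB : zmod_morphism phi.
  move=> x y; rewrite /phi; have := (memK x, memK y, memK (x - y)).
  case: (boolP (x \is a GRing.unit)) => ux;
    case: (boolP (y \is a GRing.unit)) => uy /= [[xK yK]].
  - by rewrite unitB // => /esym/negbTE ->; rewrite subrr.
  - case: (x - y \is a GRing.unit) => /= [_|xyK]; first by rewrite subr0.
    by move: xK; rewrite -(subrK y x) KD.
  - case: (x - y \is a GRing.unit) => /= [_|xyK]; first exact/val_inj.
    by move: yK; rewrite -(subKr x y) KB.
  - by rewrite KB // => /esym/negbTE ->; rewrite subrr.
have phiM : monoid_morphism phi.
  split=> [|x y]; first by rewrite /phi unitr1.
  by rewrite /phi unitrM -natrM mulnb.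
pose Phi : {rmorphism R -> 'F_2} := HB.pack phi
  (GRing.isZmodMorphism.Build _ _ phi phiB)
  (GRing.isMonoidMorphism.Build _ _ phi phiM).
by exists Phi => x; rewrite /= /phi; case: (x \is a GRing.unit).
Qed.

(** The element s is the image of 1 under the isomorphism from
R / J(R) to the socle. *)
Lemma local_frobenius_socle_elt (R : finComUnitRingType) :
  frobenius_ring R -> local_ring R ->
  exists2 s : R, s != 0 & forall x, x \isn't a GRing.unit -> x * s = 0.
Proof.
move=> [f [fD fM f_inj _]] hloc; have [K [maxK _]] := hloc.
rewrite (jacobson_local hloc maxK) in fD fM f_inj.
have f0 : f (ideal_coset K 0) = 0 by have := fM 0 0; rewrite !mul0r.
exists (f (ideal_coset K 1)); last move=> x.
  rewrite -f0 (inj_in_eq f_inj) ?imset_f // ideal_coset_eq0 //.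
  by have [] := maximal_ideal_closed maxK.
rewrite -(mem_maximal_local hloc maxK) -(ideal_coset_eq0 _ maxK) => /eqP eqx.
by rewrite -fM mulr1 eqx.
Qed.

(** * Self-dual codes generated by square block matrices *)

Lemma self_dual_mul_tr (R : finComNzRingType) m n (M : 'M[R]_(m, n)) :
  self_dual (row_code M) -> M *m M^T = 0.
Proof.
move=> sd; apply/matrixP=> i j; rewrite [LHS]mxE [RHS]mxE.
have rowC l : row l M \in row_code M by rewrite rowE; apply: imset_f.
have: row i M \in dual_code (row_code M) by rewrite -sd.
rewrite inE => /forall_inP/(_ _ (rowC j))/eqP; apply: etrans.
by apply: eq_bigr => l _; rewrite !mxE.
Qed.

(** By counting: the dual code is the kernel of x |-> x M^T, which maps
R^(2m) to R^m, so it has at least |R|^m elements; being equal to it, the image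
of u |-> u M has at least as many elements as R^m. *)
Lemma self_dual_inj (R : finComNzRingType) m (M : 'M[R]_(m, m + m)) :
  self_dual (row_code M) -> injective (fun u : 'rV_m => u *m M).
Proof.
move=> sd; pose g (x : 'rV[R]_(m + m)) := x *m M^T.
have dualE x : (x \in row_code M) = (g x == 0).
  rewrite sd inE; apply/forall_inP/eqP => [xC|gx0 _ /imsetP[u _ ->]].
    apply/rowP=> i; rewrite [LHS]mxE [RHS]mxE.
    have /xC/eqP : row i M \in row_code M by rewrite rowE; apply: imset_f.
    apply: etrans.
    by apply: eq_bigr => l _; rewrite !mxE.
  have /matrixP/(_ 0 0) : x *m (u *m M)^T = 0.
    by rewrite trmx_mul mulmxA -/(g x) gx0 mul0mx.
  rewrite [LHS]mxE [RHS]mxE => xy0; apply/eqP/(etrans _ xy0).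
  by apply: eq_bigr => l _; rewrite [in RHS]mxE.
(* A word x is recovered from g x and the difference between x and a fixed
   preimage of g x, which lies in the dual code. *)
pose sec y := odflt 0 [pick x | g x == y].
have secP x : g (sec (g x)) = g x.
  by rewrite /sec; case: pickP => [z /eqP //|/(_ x)]; rewrite eqxx.
pose C := row_code M.
have card_le : (#|{: 'rV[R]_(m + m)}| <= #|{: 'rV[R]_m}| * #|C|)%N.
  pose h x := (g x, x - sec (g x)).
  have h_inj : injective h.
    by move=> x y [gxy]; rewrite gxy => /addIr.
  rewrite -(card_imset _ h_inj) -cardsT -cardsX; apply/subset_leq_card/subsetP.
  move=> _ /imsetP[x _ ->]; rewrite !inE /= dualE /g mulmxBl -/(g _) -/(g _).
  by rewrite secP subrr.
have injT : {in predT &, injective (fun u : 'rV_m => u *m M)}.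
  apply/imset_injP; rewrite eqn_leq leq_imset_card /=.
  move: card_le; rewrite !card_mx !mul1n expnD leq_pmul2l //.
  by rewrite expn_gt0; apply/orP; left; apply/card_gt0P; exists 0.
by move=> u v; apply: injT.
Qed.

(** A dependency modulo the maximal ideal, multiplied by a nonzero s that
this ideal kills, is a dependency over R; it is trivial only if s kills all the
coefficients, i.e. if none of them is a unit. *)
Lemma residue_rows_free (R : finComUnitRingType) (phi : {rmorphism R -> 'F_2})
    m (M : 'M[R]_(m, m + m)) :
  frobenius_ring R -> local_ring R ->
  (forall x, (phi x != 0) = (x \is a GRing.unit)) ->
  self_dual (row_code M) ->
  forall u : 'rV_m, u *m map_mx phi M = 0 -> u = 0.
Proof.
move=> hFrob hloc phiE sd u uM0.
have [s nz_s sK] := local_frobenius_socle_elt hFrob hloc.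
(* A lift of u to R, with entries 0 and 1. *)
pose v : 'rV[R]_m := \row_j (u 0 j)%:R.
have phi_v : map_mx phi v = u.
  apply/rowP=> j; rewrite !mxE rmorph_nat.
  by case: (u 0 j) => [[|[|//]] lt]; apply/val_inj.
have /(self_dual_inj sd) sv0 : (s *: v) *m M = 0 *m M.
  rewrite mul0mx -scalemxAl; apply/rowP=> j; rewrite [LHS]mxE [RHS]mxE mulrC.
  apply: sK; rewrite -phiE negbK.
  have /rowP/(_ j) : map_mx phi (v *m M) = 0 by rewrite map_mxM phi_v.
  by rewrite mxE [RHS]mxE => ->.
rewrite -phi_v; apply/rowP=> j; rewrite mxE [RHS]mxE.
apply: contraNeq nz_s; rewrite phiE => /mulIr inj; apply/eqP/inj.
by move/rowP/(_ j): sv0; rewrite mul0r mxE [in RHS]mxE.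
Qed.

Lemma block_circulant3_row_sum (F : nzRingType) p (B : 'I_3 -> 'M[F]_p)
    m (u : 'M_(m, p)) :
  row_mx u (row_mx u u) *m block_circulant3 B =
  row_mx (u *m \sum_i B i) (row_mx (u *m \sum_i B i) (u *m \sum_i B i)).
Proof.
rewrite /block_circulant3 !mul_row_col !mul_mx_row !add_row_mx.
rewrite !big_ord_recl big_ord0 addr0.
have -> : lift ord0 ord0 = 1 :> 'I_3 by apply/val_inj.
have -> : lift ord0 (lift ord0 ord0) = 2 :> 'I_3 by apply/val_inj.
rewrite -!mulmxDr; congr (row_mx _ (row_mx _ _)); congr (u *m _).
- by rewrite (addrC (B 2)).
- by rewrite addrCA.
- by rewrite addrC (addrC (B 1)) -addrA.
Qed.

Lemma map_block_circulant3 (R S : nzRingType) (f : R -> S) p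
    (B : 'I_3 -> 'M[R]_p) :
  map_mx f (block_circulant3 B) = block_circulant3 (fun i => map_mx f (B i)).
Proof. by rewrite /block_circulant3 !map_col_mx !map_row_mx. Qed.

(** The left-hand side is the matrix of scalar products of the sum of the block
rows with the first block row. *)
Lemma block_circulant3_gram (F : comNzRingType) p (B : 'I_3 -> 'M[F]_p) :
  row_mx 1%:M (row_mx 1%:M 1%:M) *m block_circulant3 B
    *m (row_mx 1%:M (row_mx 0 0) *m block_circulant3 B)^T
  = (\sum_i B i) *m (\sum_i B i)^T.
Proof.
rewrite block_circulant3_row_sum mul1mx.
rewrite /block_circulant3 !mul_row_col !mul0mx !addr0 mul1mx.
rewrite !tr_row_mx !mul_row_col -!mulmxDr -!linearD /=.
rewrite !big_ord_recl big_ord0 addr0.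
have -> : lift ord0 ord0 = 1 :> 'I_3 by apply/val_inj.
by have -> : lift ord0 (lift ord0 ord0) = 2 :> 'I_3 by apply/val_inj.
Qed.

Lemma is_circulant_map_sum (R S : nzRingType) (f : {rmorphism R -> S}) n
    (I : finType) (B : I -> 'M[R]_n) :
  (forall i, is_circulant (B i)) -> is_circulant (map_mx f (\sum_i B i)).
Proof.
move=> cB i j; rewrite !mxE !summxE; congr (f _).
by apply: eq_bigr => k _; apply: cB.
Qed.

Theorem theorem4p6 (R : finComUnitRingType)
    (hFrob : frobenius_ring R)
    (hchar : 2%N \in [pchar R])
    (hloc : local_ring R)
    (hres : forall m : {set R}, maximal_ideal m -> #|ideal_quotient m| = 2%N)
    (p k : nat) (hp : prime p) (hpk : p = (4 * k + 3)%N) (hk : ~~ odd k)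
    (a b c : 'I_3 -> R) (A : 'I_3 -> 'M[R]_p)
    (hA : forall i : 'I_3, is_circulant (A i)) :
  let Q := fun i : 'I_3 => quadratic_circulant p (a i) (b i) (c i) in
  let M := row_mx (block_circulant3 Q) (block_circulant3 A) in
  self_dual (row_code M) ->
  \sum_(i < 3) Q i \in unitmx.
Proof.
move=> Q M sd.
have [phi phiE] := residue_morphism hloc hres.
have cQ i : is_circulant (Q i) by apply: circulant_mxP.
have free := residue_rows_free hFrob hloc phiE sd.
have gram := self_dual_mul_tr sd.
(* m is (p - 1) / 2. *)
pose m := (4 * k./2 + 1)%N.
have def_p : p = (8 * k./2 + 3)%N by rewrite hpk -{1}(even_halfK hk); lia.
have dv : (p %| 2 ^ m + 1)%N.
  rewrite (dvdn_pcharf (pchar_Fp hp)) natrD natrX.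
  by rewrite (Fp_two_pow_3mod8 hp def_p) addNr.
rewrite unitmxE -phiE -det_map_mx.
have eqQA : map_mx phi (\sum_i Q i) *m (map_mx phi (\sum_i Q i))^T =
            map_mx phi (\sum_i A i) *m (map_mx phi (\sum_i A i))^T.
  rewrite !map_trmx -!map_mxM; congr (map_mx _ _).
  apply/eqP; rewrite -subr_eq0 -[- (_ *m _)]scaleN1r oppr_pchar2 // scale1r.
  rewrite -!block_circulant3_gram -mul_row_col -tr_row_mx -!mul_mx_row.
  by rewrite trmx_mul mulmxA -(mulmxA _ _ M^T) gram mulmx0 mul0mx.
have freeQA (u : 'rV_p) : u *m map_mx phi (\sum_i Q i) = 0 ->
    u *m map_mx phi (\sum_i A i) = 0 -> u = 0.
  move=> uQ uA.
  have mapS (B : 'I_3 -> 'M[R]_p) :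
      \sum_i map_mx phi (B i) = map_mx phi (\sum_i B i) by rewrite raddf_sum.
  have /free : row_mx u (row_mx u u) *m map_mx phi M = 0.
    rewrite map_row_mx !map_block_circulant3 mul_mx_row.
    by rewrite !block_circulant3_row_sum !mapS uQ uA !row_mx0.
  by rewrite -[RHS]row_mx0 => /eq_row_mx[].
have := is_circulant_map_sum phi cQ; have := is_circulant_map_sum phi hA.
(* Matrix powers need a dimension of the form n.+1. *)
case: p dv hp hpk def_p A hA Q M sd cQ free gram eqQA freeQA => // n dv.
move=> _ _ _ A hA Q M _ _ _ _ eqQA freeQA cA' cQ'.
by apply: (det_circulant_neq0 _ dv cQ' cA' eqQA freeQA); rewrite /m addn1.
Qed.
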